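(* Let $n\geq 1$ and let $P_{2n+1}$ be the path on $2n+1$ vertices. Then its Lanzhou inertia is $In(A_{Lz}(P_{2n+1}))=(n,n,1)$.
   Context: Graphs are finite, simple and undirected. For a graph $G$ on $N$ vertices, $d_G(u)$ is the degree of $u$ in $G$ and $d_{\overline{G}}(u)=N-1-d_G(u)$ is its degree in the complement $\overline{G}$. The Lanzhou matrix $A_{Lz}(G)$ is the real symmetric $N\times N$ matrix indexed by vertices whose $(u,v)$ entry is $d_G(u)d_{\overline{G}}(u)+d_G(v)d_{\overline{G}}(v)$ if $u$ and $v$ are adjacent in $G$, and $0$ otherwise. The inertia $In(M)=(n_+,n_-,n_0)$ of a real symmetric matrix $M$ gives its numbers of positive, negative and zero eigenvalues (with multiplicity). *)

(* Defs.v *)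
From HB Require Import structures.
From mathcomp Require Import all_boot all_order all_algebra.
From mathcomp Require Import polyrcf reals.

Set Implicit Arguments.
Unset Strict Implicit.
Unset Printing Implicit Defensive.

Import Order.TTheory GRing.Theory Num.Theory.

Local Open Scope ring_scope.

Record sgraph (N : nat) := SGraph {
  adj :> rel 'I_N;
  adj_sym : symmetric adj;
  adj_irrefl : irreflexive adj
}.

Definition deg N (G : sgraph N) (u : 'I_N) : nat := #|[set v | G u v]|.

Section Complement.
Variables (N : nat) (G : sgraph N).

Definition compl_adj : rel 'I_N := fun u v => (u != v) && ~~ G u v.

Lemma compl_adj_sym : symmetric compl_adj.
Proof. by move=> u v; rewrite /compl_adj eq_sym adj_sym. Qed.

Lemma compl_adj_irrefl : irreflexive compl_adj.
Proof. by move=> u; rewrite /compl_adj eqxx. Qed.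

Definition compl : sgraph N := SGraph compl_adj_sym compl_adj_irrefl.

End Complement.

Lemma deg_compl N (G : sgraph N) (u : 'I_N) :
  deg (compl G) u = (N - 1 - deg G u)%N.
Proof.
have -> : deg (compl G) u = #|~: (u |: [set v | G u v])|.
  by apply: eq_card => v; rewrite !inE /= /compl_adj negb_or eq_sym.
by rewrite cardsCs setCK card_ord cardsU1 inE adj_irrefl subnDA.
Qed.

Section Path.
Variable N : nat.

Definition path_adj : rel 'I_N := fun i j => (i.+1 == j) || (j.+1 == i).

Lemma path_adj_sym : symmetric path_adj.
Proof. by move=> i j; rewrite /path_adj orbC. Qed.

Lemma path_adj_irrefl : irreflexive path_adj.
Proof. by move=> i; rewrite /path_adj orbb gtn_eqF. Qed.

Definition path_graph : sgraph N := SGraph path_adj_sym path_adj_irrefl.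

End Path.

Definition lanzhou_mx (R : pzRingType) N (G : sgraph N) : 'M[R]_N :=
  \matrix_(u, v)
    if G u v
    then (deg G u * deg (compl G) u + deg G v * deg (compl G) v)%N%:R
    else 0.

(* Multiplicities are algebraic. Only the eigenvalues lying in R are counted,
   which for a symmetric matrix over a real closed field is all of them. *)
Definition inertia (R : rcfType) N (M : 'M[R]_N) : nat * nat * nat :=
  let p := char_poly M in
  (\sum_(a <- rootsR p | (0 < a)%R) mup a p,
   \sum_(a <- rootsR p | (a < 0)%R) mup a p,
   mup 0 p)%N.

(* Main.v *)
(* Diagonalise the matrix A over the reals. As the path is bipartite, conjugating
   by the diagonal matrix S of signs (-1)^i turns A into -A, so the spectrum is
   symmetric and n_+ = n_-. Deleting the first column and the last row of A leaves
   a triangular matrix whose diagonal entries are the positive edge weights, so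
   rank A >= 2n and n_0 <= 1; the order 2n+1 being odd, n_0 = 1. *)
Require Import Defs.
From mathcomp Require Import all_boot all_order all_algebra.
From mathcomp Require Import polyrcf complex.
From mathcomp Require Import reals zify.

Set Implicit Arguments.
Unset Strict Implicit.
Unset Printing Implicit Defensive.

Import Order.TTheory GRing.Theory Num.Theory.

Section Inertia.
Local Open Scope ring_scope.

(** The relation lifts to the characteristic matrices over the polynomial ring, where [\det PX] is a
    nonzero constant and cancels. *)
Lemma char_poly_similar (F : fieldType) n (P A B : 'M[F]_n) :
  P \in unitmx -> P *m A = B *m P -> char_poly A = char_poly B.
Proof.
move=> Pu PA; pose PX := map_mx polyC P.
have detPX : \det PX != 0.
  by rewrite det_map_mx polyC_eq0 -unitfE -unitmxE.
have : PX *m char_poly_mx A = char_poly_mx B *m PX.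
  by rewrite mulmxBr mulmxBl -!map_mxM PA scalar_mxC.
by move=> /(congr1 determinant); rewrite !det_mulmx mulrC => /(mulIf detPX).
Qed.

Lemma char_poly_diag (R : comNzRingType) n (d : 'rV[R]_n) :
  char_poly (diag_mx d) = \prod_(x <- [seq d 0 i | i <- enum 'I_n]) ('X - x%:P).
Proof.
rewrite char_poly_trig ?diag_mx_is_trig // big_map big_enum.
by apply: eq_bigr => i _; rewrite mxE eqxx.
Qed.

(** Over [R[i]] the matrix becomes hermitian, so the spectral theorem diagonalises it with a real
    diagonal. Real matrices that are similar over [R[i]] are already similar through a real matrix,
    which brings the result back to [R]. *)
Lemma symmetric_real_diag (R : rcfType) n (A : 'M[R]_n) :
  A^T = A -> exists2 P : 'M[R]_n, P \in unitmx &
    exists d : 'rV[R]_n, P *m A = diag_mx d *m P.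
Proof.
move=> As; pose f : {rmorphism R -> R[i]} := real_complex R.
have realf m p (B : 'M[R]_(m, p)) : map_mx f B \is a mxOver Num.real.
  by apply/mxOverP => i j; rewrite mxE complex_real.
have realE m p (B : 'M[R[i]]_(m, p)) :
    B \is a mxOver Num.real -> exists B0, B = map_mx f B0.
  move=> /mxOverP Br; exists (map_mx (@complex.Re R) B); apply/matrixP => i j.
  by rewrite !mxE /= RRe_real.
have Ah : map_mx f A \is hermsymmx.
  apply: realsym_hermsym; last exact: realf.
  by apply/is_hermitianmxP; rewrite expr0 scale1r map_mx_id // map_trmx As.
have Asp := orthomx_spectralP (hermitian_normalmx Ah).
have [d spE] := realE _ _ _ (hermitian_spectral_diag_real Ah).
have sim : similar_in unitmx (map_mx f A) (diag_mx (spectral_diag (map_mx f A))).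
  exists (spectralmx (map_mx f A)); first exact: spectral_unit.
  apply/similarP; first exact: spectral_unit.
  by rewrite {2}Asp !mulmxA mulmxV ?spectral_unit // mul1mx.
case: (real_similar sim); first exact: realf.
  by rewrite spE -map_diag_mx realf.
move=> Q /andP[Qr Qu] /(similarP Qu).
have [P QE] := realE _ _ _ Qr; rewrite QE spE -map_diag_mx -!map_mxM => PA.
exists P; first by rewrite -(map_unitmx f) -QE.
by exists d; apply: map_mx_inj PA.
Qed.

(** The matrix is a sum of matrices of rank at most one, one for each nonzero diagonal entry. *)
Lemma rank_diag_leq (F : fieldType) n (d : 'rV[F]_n) :
  (\rank (diag_mx d) <= #|[pred i | d 0%R i != 0%R]|)%N.
Proof.
rewrite diag_mx_sum_delta (bigID (fun i => d 0 i != 0)) /= [X in _ + X]big1.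
  rewrite addr0 -sum1_card.
  elim/big_ind2: _ => [|m1 B1 m2 B2 le1 le2|i _]; first by rewrite mxrank0.
    by apply: leq_trans (mxrank_add _ _) _; apply: leq_add.
  by apply: leq_trans (mxrank_scale _ _) _; rewrite mxrank_delta.
by move=> i; rewrite negbK => /eqP->; rewrite scale0r.
Qed.

Lemma sum_mup_rootsR (R : rcfType) (s : seq R) (P : pred R) :
  (\sum_(a <- rootsR (\prod_(x <- s) ('X - x%:P)) | P a)
      mup a (\prod_(x <- s) ('X - x%:P)) = count P s)%N.
Proof.
set p := \prod_(x <- s) _.
have p0 : p != 0 by rewrite monic_neq0 // monic_prod_XsubC.
have rp : perm_eq (rootsR p) (undup s).
  apply: uniq_perm; rewrite ?undup_uniq ?uniq_roots // => x.
  by rewrite mem_undup -(roots_on_rootsR p0) in_itv /= root_prod_XsubC.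
(* The count over [s] is regrouped by distinct values, each weighted by its number of occurrences,
   which is its multiplicity as a root. *)
rewrite (perm_big _ rp) -sum1_count -[RHS]big_undup_iterop_count /=.
apply: eq_bigr => a _; rewrite mu_prod_XsubC.
by rewrite Monoid.iteropE iter_addn_0 mul1n.
Qed.

Lemma inertia_diag (R : rcfType) n (A : 'M[R]_n) (s : seq R) :
  char_poly A = \prod_(x <- s) ('X - x%:P) ->
  inertia A = (count (> 0) s, count (< 0) s, count_mem 0 s).
Proof. by rewrite /inertia => ->; rewrite !sum_mup_rootsR mu_prod_XsubC. Qed.

Lemma rank_hessenberg (F : fieldType) m (A : 'M[F]_m.+1) :
  (forall i j : 'I_m.+1, (i.+1 < j)%N -> A i j = 0) ->
  (forall i j : 'I_m.+1, i.+1 = j -> A i j != 0) -> (m <= \rank A)%N.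
Proof.
move=> A0 A1; pose B := colsub (lift ord0) (rowsub (lift ord_max) A).
(* The entry of [B] at [i], [j] is that of [A] at [i], [j.+1], so the superdiagonal of [A] becomes
   the diagonal of [B]. *)
have Bu : B \in unitmx.
  rewrite unitmxE det_trig; last first.
    by apply/is_trig_mxP => i j ij; rewrite !mxE A0 // lift_max lift0.
  rewrite unitfE; apply/prodf_neq0 => i _; rewrite !mxE A1 //.
  by rewrite lift_max lift0.
suff: (\rank B <= \rank A)%N by rewrite mxrank_unit.
rewrite -mxrank_tr trmx_mxsub.
apply: leq_trans (mxrankS (rowsub_sub _ _)) _.
by rewrite mxrank_tr (mxrankS (rowsub_sub _ _)).
Qed.

Lemma inertia_bipartite_corank1 (R : rcfType) n (A : 'M[R]_((2 * n).+1)) :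
  A^T = A ->
  (forall i j, A i j != 0 -> odd (i + j)) ->
  (2 * n <= \rank A)%N ->
  inertia A = (n, n, 1%N).
Proof.
move=> As Aodd rkA; have [P Pu [d PA]] := symmetric_real_diag As.
pose s := [seq d 0 i | i <- enum 'I_(2 * n).+1].
have cA : char_poly A = \prod_(x <- s) ('X - x%:P).
  by rewrite (char_poly_similar Pu PA) char_poly_diag.
have cNA : char_poly (- A) = \prod_(x <- map -%R s) ('X - x%:P).
  rewrite (@char_poly_similar _ _ P _ (diag_mx (- d))) //; last first.
    by rewrite mulmxN PA raddfN mulNmx.
  rewrite char_poly_diag.
  suff -> : map -%R s = [seq (- d) 0 i | i <- enum 'I_(2 * n).+1] by [].
  by rewrite -map_comp; apply: eq_map => i; rewrite /= mxE.
pose S : 'M[R]_((2 * n).+1) := diag_mx (\row_i (-1) ^+ i).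
have Su : S \in unitmx.
  rewrite unitmxE det_diag unitfE; apply/prodf_neq0 => i _.
  by rewrite mxE signr_eq0.
have SA : S *m A = - A *m S.
  apply/matrixP => i j; rewrite mul_diag_mx mul_mx_diag !mxE.
  (* Where [A i j] is nonzero, [i] and [j] have opposite parities, hence opposite signs in [S]. *)
  have [->|/Aodd] := eqVneq (A i j) 0; first by rewrite oppr0 mulr0 mul0r.
  rewrite oddD mulrC mulNr -mulrN -(signr_odd _ i) -(signr_odd _ j).
  by case: (odd i); case: (odd j); rewrite ?expr1 ?expr0 ?opprK.
(* Equal split polynomials have the same multiset of roots. *)
have sN : perm_eq s (map -%R s).
  by apply: prod_XsubC_eq; rewrite -cA -cNA (char_poly_similar Su SA).
rewrite (inertia_diag cA).
have eqPN : count (> 0) s = count (< 0) s.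
  rewrite (permP sN) count_map; apply: eq_count => x /=.
  by rewrite oppr_gt0.
have szs : size s = (2 * n).+1 by rewrite size_map -cardE card_ord.
have tot : (count (> 0)%R s + count (< 0)%R s + count_mem 0%R s = size s)%N.
  elim: (s) => //= x t <-; case: (ltgtP x 0) => _; lia.
(* Since [P] is invertible, [A] and [diag_mx d] have the same rank. *)
have nz : (2 * n <= count (predC (pred1 0%R)) s)%N.
  have -> : count (predC (pred1 0%R)) s = #|[pred i | d 0%R i != 0%R]|.
    by rewrite count_map cardE enumT -size_filter.
  apply: leq_trans (rank_diag_leq d); apply: leq_trans rkA _.
  rewrite -(mxrankMfree (diag_mx d) (B := P)) ?row_free_unit // -PA.
  by rewrite eqmxMfull ?row_full_unit.
have := count_predC (pred1 0%R) s.
(* Twice the positive count plus the zero count is [2 * n + 1], and the zero count is at most 1;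
   parity decides. *)
by rewrite szs -eqPN in tot * => cz; congr (_, _, _); lia.
Qed.

(** Both ends have a neighbour, so one end with a non-neighbour suffices: vertex 2 for [i] when [i]
    is 0, and [i.-1] for [j] otherwise. On two vertices the only edge would have weight 0. *)
Lemma path_edge_weight_gt0 N (i j : 'I_N) : (2 < N)%N -> i.+1 = j ->
  (0 < deg (path_graph N) i * deg (compl (path_graph N)) i +
       deg (path_graph N) j * deg (compl (path_graph N)) j)%N.
Proof.
move=> N2 ij.
have di : (0 < deg (path_graph N) i)%N.
  by apply/card_gt0P; exists j; rewrite inE /= /path_adj ij eqxx.
have dj : (0 < deg (path_graph N) j)%N.
  by apply/card_gt0P; exists i; rewrite inE /= /path_adj ij eqxx orbT.
rewrite addn_gt0 !muln_gt0 di dj /=.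
have [i0|i0] := posnP i; apply/orP.
  left; apply/card_gt0P; exists (Ordinal N2).
  by rewrite inE /= /compl_adj /= /path_adj -val_eqE /= i0.
have lti : (i.-1 < N)%N by apply: leq_ltn_trans (leq_pred _) (ltn_ord i).
right; apply/card_gt0P; exists (Ordinal lti).
rewrite inE /= /compl_adj /= /path_adj -val_eqE /=; lia.
Qed.

End Inertia.

Theorem theorem38 (R : realType) (n : nat) (hn : (1 <= n)%N) :
  inertia (lanzhou_mx R (path_graph (2 * n + 1))) = (n, n, 1%N).
Proof.
rewrite addn1; apply: inertia_bipartite_corank1.
- by apply/matrixP => i j; rewrite !mxE adj_sym addnC.
- move=> i j; rewrite mxE /= /path_adj.
  case: ifP => [/orP[]/eqP<- _|_ /eqP//]; lia.
- apply: rank_hessenberg => i j ij; rewrite mxE /= /path_adj.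
    by case: ifP => // /orP[]; lia.
  (* Here [hn] provides the three vertices that make the weights positive. *)
  rewrite ij eqxx /= pnatr_eq0 -lt0n path_edge_weight_gt0 //; lia.
Qed.
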